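(* Let $\gamma^\delta>0$. Set $|\!|\!|\cdot|\!|\!|_X:=\|G\,\cdot\|_{Y'}$. For $f\in Y'$, $u=G^{-1}f$ and $$u^\delta:=\operatorname*{argmin}_{z\in X^\delta}\tfrac12\sup_{0\ne y\in Y^\delta}\frac{|(Gz-f)(y)|^2}{\|y\|_Y^2},$$ it holds that $$\inf_{u\in X\setminus X^\delta}\ \frac{\inf_{w\in X^\delta}|\!|\!|u-w|\!|\!|_X}{|\!|\!|u-u^\delta|\!|\!|_X}=\gamma^\delta,$$ and so $$\|u-u^\delta\|_X\le\frac{\|G\|_{\mathcal L(X,Y')}\,\|G^{-1}\|_{\mathcal L(Y',X)}}{\gamma^\delta}\inf_{w\in X^\delta}\|u-w\|_X.$$
   Context: Let $0\le k\le m$, $m\ge1$, and let $X$ and $Y_1,\dots,Y_m$ be real Hilbert spaces. Set $Y:=Y_1\times\cdots\times Y_m$ with $\|y\|_Y^2=\sum_i\|y_i\|_{Y_i}^2$, so that $Y'=Y_1'\times\cdots\times Y_m'$ with $\|g\|_{Y'}^2=\sum_i\|g_i\|_{Y_i'}^2$ and $g(y)=\sum_i g_i(y_i)$. Let $G=(G_1,\dots,G_m)\colon X\to Y'$, with $G_i\in\mathcal L(X,Y_i')$, be a boundedly invertible linear operator. (For $k+1\le i\le m$ the residual component is originally given with values in $Y_i$; it is identified with an element of $Y_i'$ through the isometric Riesz map.) Let $X^\delta\subset X$ be a finite dimensional subspace. For $1\le i\le k$ let $Y_i^\delta\subset Y_i$ be a finite dimensional subspace, and for $k+1\le i\le m$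 let $Y_i^\delta:=Y_i$. Set $Y^\delta:=Y_1^\delta\times\cdots\times Y_m^\delta$ and $$\gamma^\delta:=\inf_{\{z\in X^\delta:\ Gz\ne0\}}\frac{\sup_{0\ne y\in Y^\delta}\frac{|(Gz)(y)|}{\|y\|_Y}}{\|Gz\|_{Y'}}.$$ In the infimum over $u\in X\setminus X^\delta$, $u^\delta$ is the minimiser belonging to the right-hand side $f=Gu$. *)

(* Defs.v *)
From HB Require Import structures.
From mathcomp Require Import all_boot all_order all_algebra.
From mathcomp Require Import all_classical all_reals all_analysis.
From mathcomp Require Import sesquilinear.

Set Implicit Arguments.
Unset Strict Implicit.
Unset Printing Implicit Defensive.

Import Order.TTheory GRing.Theory Num.Theory.
Import numFieldNormedType.Exports.

Local Open Scope classical_set_scope.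
Local Open Scope ring_scope.

(* Real Hilbert spaces: Banach spaces whose norm comes from an inner product. *)
HB.mixin Record NormedModule_isHilbert (R : realType) H
    of NormedModule R H := {
  inner : {dot H for (@idfun R)} ;
  inner_norm : forall x : H, inner x x = `|x| ^+ 2
}.

#[short(type="hilbertType")]
HB.structure Definition Hilbert (R : realType) :=
  {H of CompleteNormedModule R H & NormedModule_isHilbert R H}.

(* The topological dual V', as a subspace of the space of functions V -> R. *)
Definition linear_continuous_pred (R : realType) (V : normedModType R) :
    {pred V -> R^o} :=
  mem [set f : V -> R^o | linear f /\ continuous f].

Lemma linear_continuous_submod_closed (R : realType) (V : normedModType R) :
  submod_closed (@linear_continuous_pred R V).
Proof.
split=> [|a f g]; rewrite !inE /=.
  split=> [b x y|x]; first by rewrite scaler0 addr0.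
  exact: cvg_cst.
move=> [lf cf] [lg cg]; split=> [b x y|x].
  rewrite !fctE lf lg !scalerDr !scalerA [b * a]mulrC.
  by rewrite -!addrA; congr (_ + _); rewrite addrCA.
by apply: cvgD; [apply: cvgZr; exact: cf | exact: cg].
Qed.

HB.instance Definition _ (R : realType) (V : normedModType R) :=
  GRing.isSubmodClosed.Build R (V -> R^o) (@linear_continuous_pred R V)
    (@linear_continuous_submod_closed R V).

Record dual (R : realType) (V : normedModType R) := Dual {
  dual_fun :> V -> R^o ;
  dual_funP : dual_fun \in @linear_continuous_pred R V }.

HB.instance Definition _ (R : realType) (V : normedModType R) :=
  [isSub for @dual_fun R V].
HB.instance Definition _ (R : realType) (V : normedModType R) :=
  [Choice of dual V by <:].
HB.instance Definition _ (R : realType) (V : normedModType R) :=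
  [SubChoice_isSubLmodule of dual V by <:].

Section Definitions.
Context {R : realType}.

(* Suprema are taken over sets of nonnegative reals, for which the value 0
   that [sup] gives to the empty set (e.g. for a zero space) is the right
   one. *)

Definition dual_norm (V : normedModType R) (g : dual V) : R :=
  sup [set `|g y| / `|y| | y in [set y : V | y != 0]].

Definition op_norm (U V : Type) (normU : U -> R) (normV : V -> R)
    (T : U -> V) : R :=
  sup [set normV (T u) / normU u | u in [set u | normU u != 0]].

Definition bounded_op (U V : Type) (normU : U -> R) (normV : V -> R)
    (T : U -> V) : Prop :=
  exists C : R, forall u, normV (T u) <= C * normU u.

Definition finite_dim_subspace (V : lmodType R) (S : set V) : Prop :=
  exists (n : nat) (e : 'I_n -> V),
    S = [set v | exists c : 'I_n -> R, v = \sum_(i < n) c i *: e i].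

Definition argmin (T : Type) (D : set T) (J : T -> R) : set T :=
  [set z | D z /\ forall w, D w -> J z <= J w].

(* Infimum in the ordered set [0, 1], so that inf set0 = 1.  It is applied
   only to sets of quotients that lie in [0, 1].  The quotients range over an
   empty set exactly when the trial space is zero (for the inf-sup constant)
   or the whole space (for the quasi-optimality constant); of the usual
   conventions this is the one under which the two constants agree in these
   cases too. *)
Definition inf01 (A : set R) : R := if `[< A !=set0 >] then inf A else 1.

Section Product.
Context {m : nat} (Y : 'I_m -> hilbertType R).

Definition prod_space := forall i, Y i.
Definition prod_dual := forall i, dual (Y i).

Definition prod_norm (y : prod_space) : R :=
  Num.sqrt (\sum_(i < m) `|y i| ^+ 2).

Definition prod_dual_norm (g : prod_dual) : R :=
  Num.sqrt (\sum_(i < m) dual_norm (g i) ^+ 2).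

Definition pairing (g : prod_dual) (y : prod_space) : R :=
  \sum_(i < m) g i (y i).

(* The nonzero elements of the product of the sets S i. *)
Definition prod_nonzero (S : forall i, set (Y i)) : set prod_space :=
  [set y | (forall i, S i (y i)) /\ y <> (fun i => 0)].

Context (X : hilbertType R).

Definition joint (G : forall i, {linear X -> dual (Y i)}) (x : X) : prod_dual :=
  fun i => G i x.

Variables (G : forall i, {linear X -> dual (Y i)}).
Variables (Xd : set X) (Yd : forall i, set (Y i)).

Definition infsup_const : R :=
  inf01 [set sup [set `|pairing (joint G z) y| / prod_norm y
                   | y in prod_nonzero Yd] / prod_dual_norm (joint G z)
         | z in [set z | Xd z /\ joint G z <> (fun i => 0)]].

Definition energy_norm (x : X) : R := prod_dual_norm (joint G x).

Definition residual_functional (f : prod_dual) (z : X) : R :=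
  2^-1 * sup [set `|pairing (fun i => G i z - f i) y| ^+ 2 / prod_norm y ^+ 2
               | y in prod_nonzero Yd].

Definition discrete_sol (f : prod_dual) : X :=
  xget 0 (argmin Xd (residual_functional f)).

Definition dist_to (N : X -> R) (u : X) : R := inf [set N (u - w) | w in Xd].

Definition quasi_opt_const : R :=
  inf01 [set dist_to energy_norm u
               / energy_norm (u - discrete_sol (joint G u))
         | u in ~` Xd].

End Product.
End Definitions.

(* Main.v *)
From HB Require Import structures.
Require Import Defs.
From mathcomp Require Import all_boot all_order all_algebra.
From mathcomp Require Import all_classical all_reals all_analysis.
From mathcomp Require Import sesquilinear ring lra.

(** Let |x|_a = |||x|||_X be the energy norm and let |x|_b be the discrete dual
    norm of G x, i.e. the supremum of |(G x)(y)| / |y| over the test space.  By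
    the Riesz theorem both come from forms on X: a(x, z) is the inner product of
    the Riesz representatives of G x and G z in Y, and b(x, z) the inner product
    of the orthogonal projections of these representatives onto the test space
    (lemmas [riesz], [sup_pairing], [energy_norm_riesz]).  As G is onto, pulling
    that projection P back to X gives for each x an element Px with
    a(Px, z) = b(x, z) = b(Px, z), that is, an a-orthogonal projection of X.
    The rest of the argument only uses the pair a, b.

    The functional to be minimised is z |-> b(z - u, z - u) / 2, so its minimiser
    p over the trial space S is characterised by b(u - p, w) = 0 for w in S; it
    exists because S is finite dimensional and is unique because
    gamma^2 a <= b on S.

    Lower bound [galerkin_quasi_optimal].  Write e = u - p.  For v in S one has
    b(e, v) = 0, so a(e, v) = a(e, v - Pv), and |v - Pv|_a^2 = a(v, v) - b(v, v)
    is at most (1 - gamma^2) |v|_a^2.  The angle between e and S therefore has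
    cosine at most sqrt(1 - gamma^2), and the a-distance of e to S, which is that
    of u, is at least gamma |e|_a.

    Upper bound [compression_sharp].  For z in S with ratio theta = |z|_b / |z|_a
    smaller than 1, take u = z - Pz.  It is b-orthogonal to everything, so its
    discrete solution is 0, while its distance to the line through z is exactly
    theta |u|_a.  Hence the quasi-optimality constant is at most theta, for each
    such z, and no infimum has to be attained.

    The estimate in the norm of X follows by applying G and its inverse to the
    quasi-optimality in the energy norm. *)

Set Implicit Arguments.
Unset Strict Implicit.
Unset Printing Implicit Defensive.

Import Order.TTheory GRing.Theory Num.Theory.
Import numFieldNormedType.Exports.

Local Open Scope classical_set_scope.
Local Open Scope ring_scope.

(** * Positive semidefinite forms and orthogonal projections *)

(** The source of every Cauchy-Schwarz type inequality below: a quadratic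
    polynomial that is nonnegative everywhere has nonpositive discriminant. *)
Lemma discriminant_le (R : realFieldType) (A B C : R) :
  0 <= C -> (forall t, 0 <= A + 2 * t * B + t ^+ 2 * C) -> B ^+ 2 <= A * C.
Proof.
move=> C0 q_ge0; have [C_eq0|C_neq0] := eqVneq C 0.
  have [->|B_neq0] := eqVneq B 0; first by rewrite C_eq0 expr0n mulr0.
  (* The polynomial is affine and takes the value -1 at this point. *)
  have := q_ge0 (- (A + 1) / (2 * B)); rewrite C_eq0.
  have -> : A + 2 * (- (A + 1) / (2 * B)) * B
            + (- (A + 1) / (2 * B)) ^+ 2 * 0 = - 1 by field.
  by rewrite oppr_ge0 ler10.
have C_gt0 : 0 < C by rewrite lt_def C_neq0.
have := q_ge0 (- B / C).
have -> : A + 2 * (- B / C) * B + (- B / C) ^+ 2 * C = (A * C - B ^+ 2) / C.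
  by field.
by rewrite pmulr_lge0 ?invr_gt0// subr_ge0.
Qed.

Section PsdForm.
Context {R : realFieldType} {V : lmodType R}.

Definition psd_form (a : V -> V -> R) : Prop :=
  [/\ forall x y, a x y = a y x,
      forall c x y z, a (c *: x + y) z = c * a x z + a y z
    & forall x, 0 <= a x x].

Context (a : V -> V -> R) (a_psd : psd_form a).

Lemma psdC x y : a x y = a y x.
Proof. by case: a_psd. Qed.

Lemma psd_ge0 x : 0 <= a x x.
Proof. by case: a_psd. Qed.

Lemma psdDl x y z : a (x + y) z = a x z + a y z.
Proof. by case: a_psd => _ aP _; rewrite -[x]scale1r aP scale1r mul1r. Qed.

Lemma psd0l z : a 0 z = 0.
Proof. by apply: (addrI (a 0 z)); rewrite -psdDl !addr0. Qed.

Lemma psdZl c x z : a (c *: x) z = c * a x z.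
Proof. by case: a_psd => _ aP _; rewrite -[c *: x]addr0 aP psd0l addr0. Qed.

Lemma psdBl x y z : a (x - y) z = a x z - a y z.
Proof. by rewrite psdDl -scaleN1r psdZl mulN1r. Qed.

Lemma psdDr x y z : a z (x + y) = a z x + a z y.
Proof. by rewrite psdC psdDl !(psdC z). Qed.

Lemma psd0r z : a z 0 = 0.
Proof. by rewrite psdC psd0l. Qed.

Lemma psdZr c x z : a z (c *: x) = c * a z x.
Proof. by rewrite psdC psdZl psdC. Qed.

Lemma psdBr x y z : a z (x - y) = a z x - a z y.
Proof. by rewrite psdC psdBl !(psdC z). Qed.

Definition psdE := (psdBl, psdBr, psdDl, psdDr, psdZl, psdZr).

Lemma psd_cauchy_schwarz x y : a x y ^+ 2 <= a x x * a y y.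
Proof.
apply: discriminant_le => [|t]; first exact: psd_ge0.
have := psd_ge0 (x + t *: y); rewrite !psdE (psdC y x).
by congr (0 <= _); ring.
Qed.

Lemma psd_eq0 x y : a y y = 0 -> a x y = 0.
Proof.
move=> y0; apply/eqP; rewrite -sqrf_eq0 eq_le sqr_ge0 andbT.
by have := psd_cauchy_schwarz x y; rewrite y0 mulr0.
Qed.

Definition subspace (S : set V) : Prop :=
  S 0 /\ forall c x y, S x -> S y -> S (c *: x + y).

Lemma subspaceB (S : set V) x y : subspace S -> S x -> S y -> S (x - y).
Proof. by case=> _ Sl Sx Sy; rewrite addrC -scaleN1r; exact: Sl. Qed.

(** Orthogonal projections onto [S] for a form that need not be definite: the
    projected vector exists but may not be unique. *)
Definition projectable (S : set V) : Prop :=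
  subspace S /\
  forall v, exists2 p, S p & forall w, S w -> a (v - p) w = 0.

Lemma projectableT : projectable setT.
Proof.
by split=> // v; exists v => // w _; rewrite subrr psd0l.
Qed.

(** One Gram-Schmidt step.  With [f] a projection of [e] on [S], only the
    component along the residual [e - f] has to be added. *)
Lemma projectable_add_line (S : set V) (e : V) : projectable S ->
  projectable [set v | exists2 x, S x & exists t, v = x + t *: e].
Proof.
move=> [[S0 Sl] proj]; split.
  split; first by exists 0 => //; exists 0; rewrite scale0r addr0.
  move=> c _ _ [x Sx [s ->]] [y Sy [t ->]]; exists (c *: x + y); first exact: Sl.
  by exists (c * s + t); rewrite scalerDr scalerA scalerDl addrACA.
move=> v; have [p Sp p_orth] := proj v; have [f Sf f_orth] := proj e.
pose t := a (v - p) (e - f) / a (e - f) (e - f).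
exists (p + t *: (e - f)).
  exists (- t *: f + p); first exact: Sl.
  by exists t; rewrite scalerBr scaleNr [- _ + p]addrC -addrA [- _ + _]addrC.
move=> _ [x Sx [s ->]].
have -> : x + s *: e = s *: (e - f) + (s *: f + x).
  by rewrite scalerBr addrA subrK addrC.
have Sw : S (s *: f + x) by exact: Sl.
rewrite opprD addrA psdBl psdDr (psdZl t) (psdDr (s *: (e - f))).
rewrite (p_orth _ Sw) (f_orth _ Sw) !addr0 !(psdZr s).
suff -> : a (v - p) (e - f) = t * a (e - f) (e - f) by ring.
(* A residual of zero length is orthogonal to everything; the division by zero
   in t then returns 0, which is a correct coefficient. *)
have [q0|q0] := eqVneq (a (e - f) (e - f)) 0; last by rewrite /t divfK.
by rewrite q0 mulr0; exact: psd_eq0.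
Qed.

End PsdForm.

Section FiniteDim.
Context {R : realType} {V : lmodType R} (a : V -> V -> R) (a_psd : psd_form a).

Lemma projectable_finite_dim (S : set V) :
  finite_dim_subspace S -> projectable a S.
Proof.
move=> [n [e ->]]; elim: n e => [|n IHn] e.
  suff -> : [set v | exists c : 'I_0 -> R, v = \sum_(i < 0) c i *: e i] = [set 0].
    split=> [|v]; first by split=> // c x y -> ->; rewrite scaler0 addr0.
    by exists 0 => // w ->; rewrite psd0r.
  apply/seteqP; split=> [v [c ->]|v ->]; first by rewrite big_ord0.
  by exists (fun=> 0); rewrite big_ord0.
pose e' i := e (widen_ord (leqnSn n) i).
have := projectable_add_line a_psd (e ord_max) (IHn e').
congr projectable; apply/seteqP; split=> v.
  move=> [_ [c ->] [t ->]].
  exists (fun i => oapp c t (unlift ord_max i)).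
  rewrite big_ord_recr /= unlift_none; congr (_ + _); apply: eq_bigr => i _; rewrite /e'.
  suff -> : widen_ord (leqnSn n) i = lift ord_max i by rewrite liftK.
  by apply: val_inj; rewrite /= /bump leqNgt ltn_ord.
move=> [c ->]; rewrite big_ord_recr.
exists (\sum_(i < n) c (widen_ord (leqnSn n) i) *: e' i).
  by exists (fun i => c (widen_ord (leqnSn n) i)).
by exists (c ord_max).
Qed.

End FiniteDim.

(** * The Riesz representation theorem *)

Section Riesz.
Context {R : realType} {H : hilbertType R}.

Lemma inner_psd : psd_form (@inner R H).
Proof.
split=> [x y|c x y z|x]; last by rewrite inner_norm sqr_ge0.
  by rewrite hermC expr0 mul1r.
by rewrite linearPl.
Qed.

Lemma inner_le_norm (x y : H) : `|inner x y| <= `|x| * `|y|.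
Proof.
rewrite -ler_sqr ?nnegrE ?mulr_ge0// exprMn real_normK ?num_real//.
by rewrite -!inner_norm; exact: psd_cauchy_schwarz inner_psd _ _.
Qed.

Lemma dual_linear (g : dual H) : linear g.
Proof. by have := dual_funP g; rewrite inE => -[]. Qed.

Lemma dual_continuous (g : dual H) : continuous (g : H -> R^o).
Proof. by have := dual_funP g; rewrite inE => -[]. Qed.

HB.instance Definition _ (g : dual H) :=
  GRing.isLinear.Build R H R^o _ (dual_fun g) (dual_linear g).

Lemma dualD (g : dual H) x y : g (x + y) = g x + g y.
Proof. exact: linearD. Qed.

Lemma dualZ (g : dual H) c x : g (c *: x) = c * g x.
Proof. exact: linearZ. Qed.

Lemma dualB (g : dual H) x y : g (x - y) = g x - g y.
Proof. exact: linearB. Qed.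

Lemma dual_bounded (g : dual H) : exists2 C : R, 0 < C & forall y, `|g y| <= C * `|y|.
Proof.
have /linear_boundedP [C [_ gC]] : bounded_near g (nbhs (0 : H)).
  exact: (@continuous_linear_bounded R H R^o 0 g (@dual_continuous g 0)).
have C1 : C < `|C| + 1 by rewrite ltr_pwDr// ler_norm.
by exists (`|C| + 1) => [|y]; [rewrite ltr_pwDr | exact: gC].
Qed.

(** The easy half of the Riesz correspondence; it turns elements of Y into
    right-hand sides of the problem. *)
Lemma inner_continuous_linear (r : H) :
  (inner r : H -> R^o) \in @linear_continuous_pred R H.
Proof.
rewrite inE; split=> [c x y|]; first by rewrite linearPr.
apply: (@bounded_linear_continuous R H R^o (inner r)).
apply/linear_boundedP; near=> M => y.
apply: le_trans (inner_le_norm r y) _; apply: ler_wpM2r; first exact: normr_ge0.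
by near: M; exact: nbhs_pinfty_ge.
Unshelve. all: by end_near. Qed.

Definition inner_dual (r : H) : dual H := Dual (inner_continuous_linear r).

(** The representative minimises J y = |y|^2 - 2 g y.  By the parallelogram law
    any minimising sequence [u] is Cauchy.  Its limit represents [g] because the
    defect of the first-order condition at [u n] is bounded by the distance of
    J (u n) to the infimum. *)
Lemma riesz (g : dual H) : exists r : H, forall y, g y = inner r y.
Proof.
have psd := inner_psd.
have [C C_gt0 gC] := dual_bounded g.
pose J (y : H) := inner y y - 2 * g y.
have J_lb y : - C ^+ 2 <= J y.
  have : 0 <= (`|y| - C) ^+ 2 by exact: sqr_ge0.
  have := ler_norm (g y); have := gC y; rewrite /J inner_norm; nra.
pose d := inf (range J).
have J_has_inf : has_inf (range J).
  by split; [exists (J 0), 0 | exists (- C ^+ 2) => _ [y _ <-]; exact: J_lb].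
have d_le y : d <= J y by apply: ge_inf; [case: J_has_inf | exists y].
have /boolp.choice [u uJ] n : exists y : H, J y - d < n.+1%:R^-1.
  have n_gt0 : 0 < n.+1%:R^-1 :> R by rewrite invr_gt0.
  have [_ [y _ <-] yd] := inf_adherent n_gt0 J_has_inf.
  by exists y; rewrite ltrBlDl.
have JD y h t : J (y + t *: h) =
    J y + 2 * t * (inner y h - g h) + t ^+ 2 * inner h h.
  rewrite /J dualD dualZ !(psdE psd) (psdC psd h y).
  by ring.
have near_min y h : (inner y h - g h) ^+ 2 <= (J y - d) * inner h h.
  apply: discriminant_le => [|t]; first exact: psd_ge0 psd h.
  by have := d_le (y + t *: h); rewrite JD; lra.
have parallelogram y z : inner (y - z) (y - z) <= 2 * (J y - d) + 2 * (J z - d).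
  (* At the midpoint of y and z the functional is at least its infimum. *)
  have := d_le (z + 2^-1 *: (y - z)).
  rewrite /J dualD dualZ dualB !(psdE psd) (psdC psd z y).
  lra.
have u_tail eps : 0 < eps -> \forall n \near \oo, J (u n) - d < eps.
  move=> eps_gt0; near=> n; apply: lt_trans (uJ n) _.
  by near: n; exact: near_infty_natSinv_lt (PosNum eps_gt0).
have u_cauchy : cauchy (u @ \oo).
  apply/cauchy_exP => eps eps_gt0.
  have eps2_gt0 : 0 < eps ^+ 2 / 4 by rewrite divr_gt0// exprn_gt0.
  have [N _ uN] := u_tail _ eps2_gt0.
  exists (u N); exists N => // n /= Nn; rewrite -ball_normE /=.
  rewrite -ltr_sqr ?nnegrE ?normr_ge0 ?(ltW eps_gt0)// -inner_norm.
  have := uN _ Nn; have := uN _ (leqnn N); have := parallelogram (u N) (u n).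
  by rewrite /=; lra.
have u_cvg : cvg (u @ \oo) by exact: cauchy_cvg.
exists (lim (u @ \oo)) => h; set r := lim _ in u_cvg *.
apply/eqP; rewrite eq_sym -subr_eq0 -normr_le0.
apply/ler_addgt0Pr => eps eps_gt0; rewrite add0r.
(* The two error terms are each at most (eps / K) |h|; adding 1 to |h| keeps K
   positive when h = 0. *)
pose K := 2 * (`|h| + 1); have K_gt0 : 0 < K by rewrite mulr_gt0// ltr_pwDr.
have q_gt0 : 0 < eps / K by rewrite divr_gt0.
have q2_gt0 : 0 < (eps / K) ^+ 2 by rewrite exprn_gt0.
near \oo => n.
have ur : `|r - u n| < eps / K by near: n; exact: cvgr_dist_lt u_cvg _ q_gt0.
have uh : `|inner (u n) h - g h| <= eps / K * `|h|.
  rewrite -ler_sqr ?nnegrE ?(mulr_ge0 (ltW q_gt0))// real_normK ?num_real//.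
  apply: le_trans (near_min (u n) h) _.
  rewrite exprMn -inner_norm ler_wpM2r ?(psd_ge0 psd)// ltW//.
  by near: n; exact: u_tail.
have -> : inner r h - g h = inner (r - u n) h + (inner (u n) h - g h).
  by rewrite (psdBl psd); ring.
apply: le_trans (ler_normD _ _) _.
apply: le_trans (lerD (inner_le_norm _ _) uh) _.
have : `|r - u n| * `|h| <= eps / K * `|h| by rewrite ler_wpM2r// ltW.
have : eps / K * (2 * (`|h| + 1)) = eps by rewrite divfK// gt_eqF.
by have := q_gt0; lra.
Unshelve. all: by end_near. Qed.

End Riesz.

(** * Infima in the unit interval *)

Section Inf01.
Context {R : realType}.

Lemma inf01_le (A : set R) x : (forall y, A y -> 0 <= y) -> A x -> inf01 A <= x.
Proof.
move=> A_ge0 Ax; rewrite /inf01; case: asboolP => [_|]; last by case; exists x.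
by apply: ge_inf => //; exists 0 => y; exact: A_ge0.
Qed.

Lemma le_inf01 (A : set R) c : c <= 1 -> (forall y, A y -> c <= y) -> c <= inf01 A.
Proof.
move=> c_le1 c_le; rewrite /inf01; case: asboolP => // A_neq0.
by apply: lb_le_inf.
Qed.

Lemma inf01_le1 (A : set R) : (forall y, A y -> 0 <= y <= 1) -> inf01 A <= 1.
Proof.
move=> A01; have [[x Ax]|] := pselect (A !=set0).
  apply: le_trans (inf01_le _ Ax) _; last by have /andP[] := A01 _ Ax.
  by move=> y /A01/andP[].
by move=> A0; rewrite /inf01; case: asboolP.
Qed.

End Inf01.

(** * Galerkin solutions for a compressed form *)

Section PetrovGalerkin.
Context {R : realType} {V : lmodType R}.
Context (a b : V -> V -> R) (S : set V).
Hypothesis a_psd : psd_form a.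
Hypothesis a_def : forall x, a x x = 0 -> x = 0.
Hypothesis b_psd : psd_form b.
(** This says that [b] is [a] composed with an [a]-orthogonal projection. *)
Hypothesis b_compression : forall x, exists p,
  (forall z, a p z = b x z) /\ (forall z, b p z = b x z).
Hypothesis S_proj : projectable b S.

Definition form_norm (c : V -> V -> R) (x : V) : R := Num.sqrt (c x x).

Definition form_infsup : R :=
  inf01 [set form_norm b z / form_norm a z | z in [set z | S z /\ z <> 0]].

Lemma energy_gt0 x : x <> 0 -> 0 < a x x.
Proof.
by move=> x0; rewrite lt_def (psd_ge0 a_psd) andbT; apply/eqP => /a_def.
Qed.

(** Pythagoras for the projection: the part removed by it has energy a - b. *)
Lemma compression_residual x p : (forall z, a p z = b x z) ->
  (forall z, b p z = b x z) -> a (x - p) (x - p) = a x x - b x x.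
Proof.
move=> ap bp; rewrite (psdBl a_psd) !(psdBr a_psd) (psdC a_psd x p) !ap.
by rewrite (psdC b_psd x p) bp; ring.
Qed.

Lemma compression_le x : b x x <= a x x.
Proof.
have [p [ap bp]] := b_compression x.
by rewrite -subr_ge0 -(compression_residual ap bp) (psd_ge0 a_psd).
Qed.

Let quotient_ge0_le1 y :
  [set form_norm b z / form_norm a z | z in [set z | S z /\ z <> 0]] y ->
  0 <= y <= 1.
Proof.
move=> [z [Sz z0] <-]; rewrite divr_ge0 ?sqrtr_ge0//=.
rewrite ler_pdivrMr ?sqrtr_gt0 ?energy_gt0// mul1r.
by rewrite ler_sqrt ?compression_le// ltW ?energy_gt0.
Qed.

Lemma form_infsup_le1 : form_infsup <= 1.
Proof. by apply: inf01_le1 => y; exact: quotient_ge0_le1. Qed.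

Hypothesis gamma_gt0 : 0 < form_infsup.

(** The inf-sup condition without quotients, hence also valid for [w = 0]. *)
Lemma form_infsup_coercive w : S w -> form_infsup ^+ 2 * a w w <= b w w.
Proof.
move=> Sw; have [->|/eqP w0] := eqVneq w 0.
  by rewrite (psd0l a_psd) (psd0l b_psd) mulr0.
have : form_infsup <= form_norm b w / form_norm a w.
  by apply: inf01_le => [y /quotient_ge0_le1/andP[]//|]; exists w.
rewrite ler_pdivlMr ?sqrtr_gt0 ?energy_gt0// -ler_sqr ?nnegrE ?sqrtr_ge0//; last first.
  by rewrite mulr_ge0 ?sqrtr_ge0// ltW.
by rewrite exprMn !sqr_sqrtr ?(psd_ge0 a_psd) ?(psd_ge0 b_psd).
Qed.

Lemma infsup_definite w : S w -> b w w = 0 -> w = 0.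
Proof.
move=> Sw bw; apply: a_def; apply/eqP; rewrite eq_le (psd_ge0 a_psd) andbT.
have := form_infsup_coercive Sw.
by rewrite bw pmulr_rle0// exprn_gt0.
Qed.

(** The optimality condition of the discrete least-squares problem. *)
Definition galerkin (u p : V) : Prop := S p /\ forall w, S w -> b (u - p) w = 0.

Lemma galerkin_ex u : exists p, galerkin u p.
Proof. by have [_ /(_ u) [p]] := S_proj; exists p. Qed.

(** By Pythagoras the functional at [z] exceeds its value at [p] by half of
    b(z - p, z - p), which vanishes only for [z = p]. *)
Lemma argmin_galerkin u p : galerkin u p ->
  argmin S (fun z => 2^-1 * b (z - u) (z - u)) = [set p].
Proof.
move=> [Sp p_orth].
have pythagoras z : S z -> b (z - u) (z - u) = b (p - u) (p - u) + b (z - p) (z - p).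
  move=> Sz; have Szp : S (z - p) by apply: subspaceB => //; case: S_proj.
  have := p_orth _ Szp; rewrite !(psdE b_psd) !(psdC b_psd p) !(psdC b_psd u z).
  lra.
apply/seteqP; split => [z [Sz z_min]|_ ->] /=.
  apply/eqP; rewrite -subr_eq0; apply/eqP; apply: infsup_definite.
    by apply: subspaceB => //; case: S_proj.
  apply/eqP; rewrite eq_le (psd_ge0 b_psd) andbT.
  by have := z_min _ Sp; rewrite (pythagoras _ Sz); lra.
split=> // w Sw; rewrite (pythagoras _ Sw).
by have := psd_ge0 b_psd (w - p); lra.
Qed.

(** With e = u - p and v = p - w in [S], the angle between [e] and [v] is bounded
    away from zero: b(e, v) = 0 allows [v] to be replaced in a(e, v) by its part
    removed by the projection, and that part is short by the inf-sup condition. *)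
Lemma galerkin_quasi_optimal u p w : galerkin u p -> S w ->
  form_infsup * form_norm a (u - p) <= form_norm a (u - w).
Proof.
move=> [Sp p_orth] Sw; have Spw : S (p - w).
  by apply: subspaceB => //; case: S_proj.
have -> : u - w = (u - p) + (p - w) by rewrite addrA subrK.
move: (p_orth _ Spw) (form_infsup_coercive Spw).
move: (u - p) (p - w) => e v e_orth v_coer.
have [q [aq bq]] := b_compression v.
have cs : a e v ^+ 2 <= a e e * ((1 - form_infsup ^+ 2) * a v v).
  have -> : a e v = a e (v - q).
    by rewrite (psdBr a_psd) (psdC a_psd e q) aq (psdC b_psd v) e_orth subr0.
  apply: le_trans (psd_cauchy_schwarz a_psd _ _) _.
  rewrite (compression_residual aq bq) ler_wpM2l ?(psd_ge0 a_psd)//.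
  by move: v_coer; lra.
rewrite -ler_sqr ?nnegrE ?sqrtr_ge0 ?mulr_ge0 ?sqrtr_ge0 ?(ltW gamma_gt0)//.
rewrite exprMn !sqr_sqrtr ?(psd_ge0 a_psd)//.
rewrite !(psdE a_psd) (psdC a_psd v e).
have := psd_ge0 a_psd e; have := psd_ge0 a_psd v; move: cs.
have := form_infsup_le1; have := gamma_gt0.
move: (a e e) (a v v) (a e v) form_infsup => A C B g g0 g1 cs C0 A0.
have g2 : 0 <= 1 - g ^+ 2 by rewrite subr_ge0 expr_le1 // ltW.
(* Arithmetic-geometric mean inequality for the two factors bounding B^2. *)
have : - (2 * B) <= (1 - g ^+ 2) * A + C.
  rewrite -[leRHS]ger0_norm ?addr_ge0 ?mulr_ge0//; apply: le_trans (ler_norm _) _.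
  rewrite -ler_sqr ?nnegrE// !real_normK ?num_real//.
  have := sqr_ge0 ((1 - g ^+ 2) * A - C); move: cs; lra.
lra.
Qed.

(** The extremal right-hand side built from [z] is its part [x] removed by the
    projection.  It is invisible to [b], and in the plane spanned by [z] and
    its projection, the angles between [x] and [z] and between [z] and its
    projection are complementary, so that the sine of the first equals
    the cosine of the second, which is the ratio of [z]. *)
Lemma compression_sharp z : S z -> b z z < a z z ->
  exists x, [/\ ~ S x, galerkin x 0 &
    exists t, form_norm a (x - t *: z)
              <= form_norm b z / form_norm a z * form_norm a x].
Proof.
move=> Sz b_lt_a; have [p [ap bp]] := b_compression z.
have az_gt0 : 0 < a z z by apply: le_lt_trans b_lt_a; exact: psd_ge0.
have x_sq := compression_residual ap bp.
have x_orth w : b (z - p) w = 0 by rewrite (psdBl b_psd) bp subrr.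
exists (z - p); split.
- move=> /infsup_definite/(_ (x_orth _)) x0; move: b_lt_a.
  by rewrite -subr_gt0 -x_sq x0 (psd0l a_psd) ltxx.
- by split=> [|w _]; [case: S_proj => -[] | rewrite subr0].
have xz : a (z - p) z = a z z - b z z by rewrite (psdBl a_psd) ap.
(* The coefficient of the a-orthogonal projection of x on the line of z. *)
exists ((a z z - b z z) / a z z).
rewrite -ler_sqr ?nnegrE ?mulr_ge0 ?invr_ge0 ?sqrtr_ge0//.
rewrite !exprMn exprVn !sqr_sqrtr ?(psd_ge0 a_psd) ?(psd_ge0 b_psd)//.
move: (z - p) x_sq xz => x x_sq xz.
rewrite !(psdE a_psd) (psdC a_psd z x) x_sq xz le_eqVlt; apply/orP; left.
by apply/eqP; field; rewrite gt_eqF.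
Qed.

(** When every [z] in [S] has ratio 1, both constants are 1; this covers a zero
    trial space and a trial space that is the whole space, where at least one
    of the two infima ranges over an empty set. *)
Lemma quasi_opt_eq_infsup (sol : V -> V) : (forall u, galerkin u (sol u)) ->
  inf01 [set inf [set form_norm a (u - w) | w in S] / form_norm a (u - sol u)
        | u in ~` S] = form_infsup.
Proof.
move=> sol_gal; set Q := (X in inf01 X).
have S0 : S 0 by case: S_proj => -[].
have err_gt0 u : ~ S u -> 0 < form_norm a (u - sol u).
  move=> Su; rewrite sqrtr_gt0 energy_gt0// => /eqP; rewrite subr_eq0 => /eqP u_sol.
  by apply: Su; rewrite u_sol; case: (sol_gal u).
have dist_ge0 u : 0 <= inf [set form_norm a (u - w) | w in S].
  apply: lb_le_inf => [|_ [w _ <-]]; last exact: sqrtr_ge0.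
  by exists (form_norm a (u - 0)), 0.
have dist_le u w : S w -> inf [set form_norm a (u - w) | w in S] <= form_norm a (u - w).
  by move=> Sw; apply: ge_inf; [exists 0 => _ [v _ <-]; exact: sqrtr_ge0 | exists w].
have Q01 y : Q y -> 0 <= y <= 1.
  move=> [u Su <-]; rewrite divr_ge0 ?dist_ge0 ?sqrtr_ge0//=.
  by rewrite ler_pdivrMr ?err_gt0// mul1r dist_le//; case: (sol_gal u).
apply/eqP; rewrite eq_le; apply/andP; split; last first.
  apply: le_inf01 => [|_ [u Su <-]]; first exact: form_infsup_le1.
  rewrite ler_pdivlMr ?err_gt0//; apply: lb_le_inf.
    by exists (form_norm a (u - 0)), 0.
  by move=> _ [w Sw <-]; exact: galerkin_quasi_optimal.
apply: le_inf01 => [|_ [z [Sz z0] <-]]; first exact: inf01_le1.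
have := compression_le z; rewrite le_eqVlt => /orP[/eqP b_eq_a|b_lt_a].
  by rewrite /form_norm b_eq_a divff ?gt_eqF ?sqrtr_gt0 ?energy_gt0//; exact: inf01_le1.
have [x [Sx x_gal [t x_le]]] := compression_sharp Sz b_lt_a.
have sol_x : sol x = 0.
  have := argmin_galerkin x_gal; rewrite (argmin_galerkin (sol_gal x)) => /seteqP[+ _].
  exact.
apply: le_trans (inf01_le (A := Q) (x := inf [set form_norm a (x - w) | w in S] /
  form_norm a (x - sol x)) _ _) _; [by move=> y /Q01/andP[] | by exists x |].
rewrite ler_pdivrMr ?err_gt0// sol_x subr0; apply: le_trans x_le; apply: dist_le.
by case: S_proj => -[_ Sl] _; rewrite -[t *: z]addr0; exact: Sl.
Qed.

End PetrovGalerkin.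

(** * Norms as suprema *)

Section Norms.
Context {R : realType}.

(** The disjunction between attainment and [N = 0] covers the empty set, on which
    [sup] is 0; it arises for zero test spaces. *)
Lemma sup_attained (A : set R) N :
  (forall x, A x -> 0 <= x <= N) -> (N != 0 -> A N) -> sup A = N.
Proof.
move=> A0N AN; have [A_neq0|] := pselect (A !=set0); last first.
  move/nonemptyPn => A0; have [->|/AN] := eqVneq N 0; last by rewrite A0.
  by rewrite A0 sup0.
have {}AN : A N.
  have [N0|/AN//] := eqVneq N 0; case: A_neq0 => x Ax.
  by have := A0N _ Ax; rewrite N0 => /le_anti ->.
apply/eqP; rewrite eq_le ge_sup//=; last by move=> x /A0N/andP[].
by apply: ub_le_sup => //; exists N => x /A0N/andP[].
Qed.

Lemma dual_norm_riesz (H : hilbertType R) (g : dual H) (r : H) :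
  (forall y, g y = inner r y) -> dual_norm g = `|r|.
Proof.
move=> gr; apply: sup_attained => [_ [y /= y0 <-]|].
  rewrite divr_ge0//= ler_pdivrMr ?normr_gt0// gr; exact: inner_le_norm.
rewrite normr_eq0 => r0; exists r => //.
by rewrite gr inner_norm normrX normr_id expr2 mulfK// normr_eq0.
Qed.

Lemma le_op_norm (U V : Type) (normU : U -> R) (normV : V -> R) (T : U -> V) u :
  (forall u, 0 <= normU u) -> (forall v, 0 <= normV v) ->
  bounded_op normU normV T -> normV (T u) <= op_norm normU normV T * normU u.
Proof.
move=> U0 V0 [C TC]; have [u0|u0] := eqVneq (normU u) 0.
  by have := TC u; rewrite u0 !mulr0.
have u_gt0 : 0 < normU u by rewrite lt_def u0 U0.
rewrite -ler_pdivrMr//; apply: ub_le_sup; last by exists u.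
exists C => _ [v /= v0 <-]; rewrite ler_pdivrMr//.
by rewrite lt_def v0 U0.
Qed.

Lemma op_norm_ge0 (U V : Type) (normU : U -> R) (normV : V -> R) (T : U -> V) :
  (forall u, 0 <= normU u) -> (forall v, 0 <= normV v) ->
  bounded_op normU normV T -> 0 <= op_norm normU normV T.
Proof.
move=> U0 V0 T_bnd; have [[u u0]|no_u] := pselect (exists u, normU u != 0).
  have := le_trans (V0 _) (le_op_norm u U0 V0 T_bnd).
  by rewrite pmulr_lge0// lt_def u0 U0.
rewrite /op_norm; suff -> : [set u | normU u != 0] = set0 by rewrite image_set0 sup0.
by rewrite -subset0 => u u0; apply: no_u; exists u.
Qed.

End Norms.

Section Product.
Context {R : realType} {m : nat} (Y : 'I_m -> hilbertType R).

Lemma prod_dual_norm_ge0 (g : prod_dual Y) : 0 <= prod_dual_norm g.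
Proof. exact: sqrtr_ge0. Qed.

Lemma prod_norm_gt0 (y : prod_space Y) : y <> (fun i => 0) -> 0 < prod_norm y.
Proof.
move=> y0; rewrite sqrtr_gt0 lt_def sumr_ge0 ?andbT => [|i _]; last exact: sqr_ge0.
apply/eqP => /psumr_eq0P => y_eq0; apply: y0; apply: functional_extensionality_dep => i.
apply/eqP; rewrite -normr_eq0 -sqrf_eq0; apply/eqP/y_eq0 => // j _; exact: sqr_ge0.
Qed.

Section TestSpaces.
Context (S : forall i, set (Y i)) (g : prod_dual Y) (r : prod_space Y).
Arguments S : clear implicits.
Hypothesis Sr : forall i, S i (r i).
Hypothesis gr : forall i y, S i y -> g i y = inner (r i) y.

Lemma pairing_le y : (forall i, S i (y i)) ->
  `|pairing g y| <= prod_norm r * prod_norm y.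
Proof.
move=> Sy; rewrite -ler_sqr ?nnegrE ?mulr_ge0 ?sqrtr_ge0//.
have sq_ge0 (v : prod_space Y) : 0 <= \sum_(i < m) `|v i| ^+ 2.
  by apply: sumr_ge0 => i _; exact: sqr_ge0.
rewrite exprMn !sqr_sqrtr// real_normK ?num_real//.
apply: discriminant_le => [|t]; first exact: sq_ge0.
have := sq_ge0 (fun i => r i + t *: y i); congr (0 <= _).
rewrite /pairing !mulr_sumr -!big_split; apply: eq_bigr => i _ /=.
rewrite gr// -!inner_norm !(psdE inner_psd) (psdC inner_psd (y i)); ring.
Qed.

Lemma pairing_riesz : pairing g r = prod_norm r ^+ 2.
Proof.
rewrite sqr_sqrtr; last by apply: sumr_ge0 => i _; exact: sqr_ge0.
by apply: eq_bigr => i _; rewrite gr// inner_norm.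
Qed.

Let quotient_le y : prod_nonzero S y ->
  0 <= `|pairing g y| / prod_norm y <= prod_norm r.
Proof.
move=> [Sy y0]; rewrite divr_ge0 ?sqrtr_ge0//=.
by rewrite ler_pdivrMr ?prod_norm_gt0// pairing_le.
Qed.

Let quotient_riesz : prod_norm r != 0 ->
  prod_nonzero S r /\ `|pairing g r| / prod_norm r = prod_norm r.
Proof.
move=> r0; split; last first.
  by rewrite pairing_riesz ger0_norm ?sqr_ge0// expr2 mulfK.
split=> // r_eq0; move: r0; rewrite r_eq0 /prod_norm big1 ?sqrtr0 ?eqxx// => i _.
by rewrite normr0 expr0n.
Qed.

(** Unless [r = 0], this supremum and the one of the squared quotients are
    attained at the representative [r] itself. *)
Lemma sup_pairing :
  sup [set `|pairing g y| / prod_norm y | y in prod_nonzero S] = prod_norm r.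
Proof.
apply: sup_attained => [_ [y Sy <-]|/quotient_riesz[Sr' r_eq]].
  exact: quotient_le.
by exists r.
Qed.

Lemma sup_sqr_pairing :
  sup [set `|pairing g y| ^+ 2 / prod_norm y ^+ 2 | y in prod_nonzero S]
  = prod_norm r ^+ 2.
Proof.
apply: sup_attained => [_ [y Sy <-]|].
  have /andP[q0 qr] := quotient_le Sy.
  by rewrite -expr_div_n sqr_ge0/= lerXn2r ?nnegrE ?sqrtr_ge0.
rewrite sqrf_eq0 => /quotient_riesz[Sr' r_eq].
by exists r => //; rewrite -expr_div_n r_eq.
Qed.

End TestSpaces.

End Product.

(** * The forms of the least-squares problem *)

Section RieszForm.
Context {R : realType} {m : nat} {X : hilbertType R} {Y : 'I_m -> hilbertType R}.
Context (G : forall i, {linear X -> dual (Y i)}).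

(** [r x i] is the Riesz representative, within the test space [S i], of the
    functional [G i x] restricted to [S i]. *)
Definition represents (S : forall i, set (Y i)) (r : X -> prod_space Y) : Prop :=
  forall x i, S i (r x i) /\ forall y, S i y -> G i x y = inner (r x i) y.

Definition riesz_form (r : X -> prod_space Y) (x z : X) : R :=
  \sum_(i < m) inner (r x i) (r z i).

(** Projecting the representative in the full space onto the test space. *)
Lemma represents_ex (S : forall i, set (Y i)) :
  (forall i, projectable inner (S i)) -> exists r, represents S r.
Proof.
move=> S_proj.
have component i : {p : X -> Y i &
    forall x, S i (p x) /\ forall y, S i y -> G i x y = inner (p x) y}.
  apply: (@boolp.choice X (Y i) (fun x q =>
    S i q /\ forall y, S i y -> G i x y = inner q y)) => x.
  have [s s_repr] := riesz (G i x); have [_ /(_ s) [p Sp p_orth]] := S_proj i.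
  exists p; split=> // y Sy.
  by apply/eqP; rewrite s_repr -subr_eq0 -(psdBl inner_psd) p_orth.
by exists (fun x i => projT1 (component i) x) => x i; exact: projT2 (component i) x.
Qed.

Section Representation.
Context (S : forall i, set (Y i)) (r : X -> prod_space Y).
Arguments S : clear implicits.
Hypothesis r_repr : represents S r.

Lemma represents_mem x i : S i (r x i).
Proof. by case: (r_repr x i). Qed.

Lemma represents_eval x i y : S i y -> G i x y = inner (r x i) y.
Proof. by case: (r_repr x i) => _; apply. Qed.

(** Linearity of the form comes from that of [G]: evaluating a functional at a
    representative is linear in the functional. *)
Lemma riesz_form_psd : psd_form (riesz_form r).
Proof.
split=> [x z|c x y z|x].
- by apply: eq_bigr => i _; exact: psdC inner_psd _ _.
- rewrite /riesz_form mulr_sumr -big_split; apply: eq_bigr => i _ /=.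
  by rewrite -!represents_eval ?linearP//; exact: represents_mem.
- by apply: sumr_ge0 => i _; exact: psd_ge0 inner_psd _.
Qed.

Lemma form_norm_riesz x : form_norm (riesz_form r) x = prod_norm (r x).
Proof.
congr Num.sqrt; apply: eq_bigr => i _; exact: inner_norm.
Qed.

End Representation.

Lemma energy_norm_riesz (r : X -> prod_space Y) : represents (fun i => setT) r ->
  energy_norm G = form_norm (riesz_form r).
Proof.
move=> r_repr; apply/funext => x; rewrite form_norm_riesz.
congr Num.sqrt; apply: eq_bigr => i _; congr (_ ^+ 2).
by apply: dual_norm_riesz => y; exact: (represents_eval r_repr).
Qed.

End RieszForm.

(** * Quasi-optimality of the minimal residual method *)

Theorem theorem3p3 (R : realType) (m k : nat)
    (m_ge1 : (1 <= m)%N) (k_le_m : (k <= m)%N)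
    (X : hilbertType R) (Y : 'I_m -> hilbertType R)
    (G : forall i : 'I_m, {linear X -> dual (Y i)})
    (Ginv : prod_dual Y -> X)
    (G_bounded : forall i : 'I_m,
      bounded_op (fun x : X => `|x|) (@dual_norm R (Y i)) (G i))
    (GK : cancel (joint G) Ginv) (GinvK : cancel Ginv (joint G))
    (Ginv_bounded :
      bounded_op (@prod_dual_norm R m Y) (fun x : X => `|x|) Ginv)
    (Xd : set X) (Xd_fin : finite_dim_subspace Xd)
    (Yd : forall i : 'I_m, set (Y i))
    (Yd_fin : forall i : 'I_m, (i < k)%N -> finite_dim_subspace (Yd i))
    (Yd_full : forall i : 'I_m, (k <= i)%N -> Yd i = [set: Y i])
    (gamma_gt0 : 0 < infsup_const G Xd Yd) :
  (* the minimiser exists and is unique *)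
  (forall f : prod_dual Y,
     argmin Xd (residual_functional G Yd f) = [set discrete_sol G Xd Yd f]) /\
  quasi_opt_const G Xd Yd = infsup_const G Xd Yd /\
  (forall (f : prod_dual Y) (u : X), u = Ginv f ->
     `|u - discrete_sol G Xd Yd f|
       <= op_norm (fun x : X => `|x|) (@prod_dual_norm R m Y) (joint G)
          * op_norm (@prod_dual_norm R m Y) (fun x : X => `|x|) Ginv
          / infsup_const G Xd Yd
          * dist_to Xd (fun x : X => `|x|) u).
Proof.
have Yd_proj i : projectable inner (Yd i).
  have [i_lt_k|k_le_i] := ltnP i k.
    by apply: projectable_finite_dim; [exact: inner_psd | exact: Yd_fin].
  by rewrite Yd_full//; exact: projectableT inner_psd.
have [r r_repr] : exists r, represents G (fun i => setT) r.
  by apply: represents_ex => i; exact: projectableT inner_psd.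
have [rd rd_repr] := represents_ex G Yd_proj.
set a := riesz_form r; set b := riesz_form rd.
have a_psd : psd_form a := riesz_form_psd r_repr.
have b_psd : psd_form b := riesz_form_psd rd_repr.
have joint_inj := can_inj GK.
have joint0 : joint G 0 = fun i => 0.
  by apply: functional_extensionality_dep => i; rewrite /joint linear0.
have energyE : energy_norm G = form_norm a := energy_norm_riesz r_repr.
have rE x i y : G i x y = inner (r x i) y by exact: (represents_eval r_repr).
have rdE x z i : G i x (rd z i) = inner (rd x i) (rd z i).
  by apply: (represents_eval rd_repr); exact: (represents_mem rd_repr).
have b_compression x : exists p,
    (forall z, a p z = b x z) /\ (forall z, b p z = b x z).
  (* p solves the full problem whose right-hand side has the projected
     representatives of G x; surjectivity of G is used here. *)
  pose p := Ginv (fun i => inner_dual (rd x i)); exists p.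
  have Gp i y : G i p y = inner (rd x i) y.
    by rewrite -[G i p]/(joint G p i) GinvK.
  split=> z; apply: eq_bigr => i _; last by rewrite -rdE Gp.
  by rewrite -rE Gp (psdC inner_psd) -rE rdE (psdC inner_psd).
have a_def x : a x x = 0 -> x = 0.
  move=> x0; apply: joint_inj; rewrite joint0; apply: functional_extensionality_dep => i.
  apply: val_inj; apply/funext => y /=.
  have /psumr_eq0P x0' : \sum_(j < m) inner (r x j) (r x j) = 0 by exact: x0.
  rewrite -[LHS]/(G i x y) rE (psdC inner_psd) (psd_eq0 inner_psd)// x0'// => j _.
  exact: psd_ge0 inner_psd _.
have Xd_proj : projectable b Xd by exact: projectable_finite_dim.
have supE x : sup [set `|pairing (joint G x) y| / prod_norm y
    | y in prod_nonzero Yd] = form_norm b x.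
  rewrite form_norm_riesz; apply: sup_pairing => i.
    exact: (represents_mem rd_repr).
  by move=> y Yy; exact: (represents_eval rd_repr).
have infsupE : infsup_const G Xd Yd = form_infsup a b Xd.
  congr inf01; apply/seteqP; split=> _ [z [Xz z0] <-]; exists z.
  - by split=> // z_eq0; apply: z0; rewrite z_eq0.
  - by rewrite supE -energyE.
  - by split=> // Gz0; apply: z0; apply: joint_inj; rewrite Gz0 joint0.
  - by rewrite supE -energyE.
rewrite infsupE in gamma_gt0 *.
have residualE u : residual_functional G Yd (joint G u) =
    fun z => 2^-1 * b (z - u) (z - u).
  apply/funext => z; congr (_ * _).
  have -> : (fun i => G i z - joint G u i) = joint G (z - u).
    by apply: functional_extensionality_dep => i; rewrite /joint linearB.
  rewrite (sup_sqr_pairing (r := rd (z - u))) => [|i|i y Yy].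
  - by rewrite -form_norm_riesz sqr_sqrtr// (psd_ge0 b_psd).
  - exact: (represents_mem rd_repr).
  - exact: (represents_eval rd_repr).
have sol_gal u : galerkin b Xd u (discrete_sol G Xd Yd (joint G u)).
  have [p p_gal] := galerkin_ex Xd_proj u.
  rewrite /discrete_sol residualE.
  rewrite (argmin_galerkin a_psd a_def b_psd b_compression Xd_proj gamma_gt0 p_gal).
  by case: xgetP => [q _ ->//|/(_ p)[]].
split; [|split].
- move=> f; have -> : f = joint G (Ginv f) by rewrite GinvK.
  rewrite residualE.
  exact: (argmin_galerkin a_psd a_def b_psd b_compression Xd_proj gamma_gt0).
- rewrite -(quasi_opt_eq_infsup a_psd a_def b_psd b_compression Xd_proj gamma_gt0 sol_gal).
  by rewrite /quasi_opt_const /dist_to energyE.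
move=> f u u_eq; have {u_eq}-> : f = joint G u by rewrite u_eq GinvK.
set p := discrete_sol _ _ _ _; set g := form_infsup a b Xd in gamma_gt0 *.
have nX_ge0 (x : X) : 0 <= `|x| by [].
have joint_bounded :
  bounded_op (fun x : X => `|x|) (@prod_dual_norm R m Y) (joint G).
  have /boolp.choice [C GC] := G_bounded.
  exists (Num.sqrt (\sum_(i < m) C i ^+ 2)) => x.
  have C2_ge0 : 0 <= \sum_(i < m) C i ^+ 2 by apply: sumr_ge0 => i _; exact: sqr_ge0.
  rewrite -[`|x|]ger0_norm// -sqrtr_sqr -sqrtrM// ler_sqrt ?mulr_ge0 ?sqr_ge0//.
  rewrite mulr_suml; apply: ler_sum => i _; rewrite -exprMn.
  have := GC i x; rewrite /joint (dual_norm_riesz (rE x i)) => le_C.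
  by rewrite lerXn2r ?nnegrE//; exact: le_trans le_C.
have err_le : `|u - p| <= op_norm (@prod_dual_norm R m Y) (fun x : X => `|x|) Ginv
    * energy_norm G (u - p).
  rewrite -{1}[u - p]GK.
  exact: (le_op_norm _ (@prod_dual_norm_ge0 R m Y) nX_ge0 Ginv_bounded).
have opG_ge0 := op_norm_ge0 nX_ge0 (@prod_dual_norm_ge0 R m Y) joint_bounded.
have opI_ge0 := op_norm_ge0 (@prod_dual_norm_ge0 R m Y) nX_ge0 Ginv_bounded.
set oG := op_norm _ _ (joint G) in opG_ge0 *.
set oI := op_norm _ _ Ginv in err_le opI_ge0 *.
have K_ge0 : 0 <= oG * oI / g by rewrite !mulr_ge0 ?invr_ge0 ?(ltW gamma_gt0).
have le_K w : Xd w -> `|u - p| <= oG * oI / g * `|u - w|.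
  move=> Xw; apply: le_trans err_le _.
  have -> : oG * oI / g * `|u - w| = oI * (oG * `|u - w| / g) by ring.
  apply: ler_wpM2l => //; rewrite ler_pdivlMr// mulrC.
  apply: le_trans (le_op_norm (u - w) nX_ge0 (@prod_dual_norm_ge0 R m Y) joint_bounded).
  rewrite -[prod_dual_norm _]/(energy_norm G (u - w)) energyE.
  exact: (galerkin_quasi_optimal a_psd a_def b_psd b_compression Xd_proj gamma_gt0).
have [[X0 _] _] := Xd_proj.
(* The constant vanishes when X is zero. *)
have [K0|K_neq0] := eqVneq (oG * oI / g) 0.
  by have := le_K _ X0; rewrite K0 !mul0r.
rewrite mulrC -ler_pdivrMr ?lt_def ?K_neq0//; apply: lb_le_inf.
  by exists `|u - 0|, 0.
move=> _ [w Xw <-]; rewrite ler_pdivrMr ?lt_def ?K_neq0// mulrC.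
exact: le_K.
Qed.
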